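(* For any $a>0$ and $T>0$, there exists $C=C(a,T)\in\mathbb R_+$ (not depending on $\varepsilon$) such that for any $\varepsilon>0$, any $k\in\mathbb N$ and any $t\in[1,\varepsilon^{-4}T]$, $$\bigg|1-\sum_{j\in\mathbb N}\mathsf p^\varepsilon_t(k,j)\bigg|\le C\exp\left(-a\,\frac{\varepsilon^2k}{\sqrt{\varepsilon^4t}}\right).$$
   Context: $\mathbb N=\{0,1,2,\dots\}$. For $\varepsilon>0$ and $\mu=e^{-\varepsilon}$, $\mathsf p^\varepsilon_t(k,\ell)$, $k,\ell\in\mathbb N$, denotes the discrete heat kernel with Robin boundary condition of parameter $\mu$: it is the transition kernel of the continuous-time random walk on $\mathbb N$ that waits an exponential time of mean $1$ at each site and then, from a site $k\ge1$, jumps to $k\pm1$ with probability $\frac12$ each, while from $0$ it jumps to $1$ with probability $\frac12$, stays at $0$ with probability $\frac\mu2$, and is killed with probability $\frac{1-\mu}2$. Equivalently, it is the kernel of $e^{t\Delta^\mu/2}$, where $\Delta^\mu f(k)=f(k+1)+f(k-1)-2f(k)$ for $k\ge1$ and $\Delta^\mu f(0)=f(1)+\mu f(0)-2f(0)$. *)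

(* Defs.v *)
From Stdlib Require Import Reals Arith Lra.
From Coquelicot Require Import Coquelicot.
Open Scope R_scope.

Definition laplacian (mu : R) (f : nat -> R) (k : nat) : R :=
  match k with
  | O => f 1%nat + mu * f 0%nat - 2 * f 0%nat
  | S k' => f (S k) + f k' - 2 * f k
  end.

(* e^A f = sum_n A^n f / n!, taken pointwise.  For A bounded on the bounded
   functions this is the usual exponential of a bounded operator;
   [ex_series_op_exp] shows that the series converges in the case used here. *)
Definition op_exp (A : (nat -> R) -> nat -> R) (f : nat -> R) (k : nat) : R :=
  Series (fun n => Nat.iter n A f k / INR (fact n)).

Definition dirac (l : nat) (k : nat) : R := if Nat.eqb k l then 1 else 0.

Definition half_laplacian (mu t : R) (f : nat -> R) (k : nat) : R :=
  t / 2 * laplacian mu f k.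

(* The kernel K of an operator B satisfies (B f)(k) = sum_l K(k, l) f(l), hence
   K(k, l) = (B 1_{l})(k). *)
Definition heat_kernel (eps t : R) (k l : nat) : R :=
  op_exp (half_laplacian (exp (- eps)) t) (dirac l) k.

Lemma laplacian_bound (mu M : R) (f : nat -> R) :
  0 <= mu <= 1 -> (forall k, Rabs (f k) <= M) ->
  forall k, Rabs (laplacian mu f k) <= 4 * M.
Proof.
intros Hmu Hf k.
assert (B : forall i, - M <= f i <= M) by (intro i; apply Rabs_le_between, Hf).
assert (HM : 0 <= M) by (specialize (B O); lra).
apply Rabs_le; destruct k as [|k]; simpl.
- pose proof (B 0%nat); pose proof (B 1%nat); split; nra.
- pose proof (B k); pose proof (B (S k)); pose proof (B (S (S k))); lra.
Qed.

Lemma iter_half_laplacian_bound (mu t M : R) (f : nat -> R) :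
  0 <= mu <= 1 -> (forall k, Rabs (f k) <= M) ->
  forall n k, Rabs (Nat.iter n (half_laplacian mu t) f k) <= M * (2 * Rabs t) ^ n.
Proof.
intros Hmu Hf n; induction n as [|n IH]; intro k; simpl.
- rewrite Rmult_1_r; apply Hf.
- unfold half_laplacian at 1.
  pose proof (laplacian_bound mu _ _ Hmu IH k) as HL.
  unfold Rdiv; rewrite !Rabs_mult, (Rabs_pos_eq (/ 2)) by lra.
  pose proof (Rabs_pos t); nra.
Qed.

Lemma ex_series_op_exp (mu t M : R) (f : nat -> R) (k : nat) :
  0 <= mu <= 1 -> (forall i, Rabs (f i) <= M) ->
  ex_series (fun n => Nat.iter n (half_laplacian mu t) f k / INR (fact n)).
Proof.
intros Hmu Hf.
apply (ex_series_le (K := R_AbsRing) (V := R_CompleteNormedModule) _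
  (fun n => M * ((2 * Rabs t) ^ n * / INR (fact n)))).
- intro n; change (Rabs (Nat.iter n (half_laplacian mu t) f k / INR (fact n))
    <= M * ((2 * Rabs t) ^ n * / INR (fact n))).
  pose proof (INR_fact_lt_0 n) as Hn; pose proof (Rinv_0_lt_compat _ Hn).
  unfold Rdiv; rewrite Rabs_mult, (Rabs_pos_eq (/ _)) by lra.
  rewrite <- Rmult_assoc; apply Rmult_le_compat_r; [lra|].
  now apply iter_half_laplacian_bound.
- apply (ex_series_scal_l M (fun n => (2 * Rabs t) ^ n * / INR (fact n))).
  exists (exp (2 * Rabs t)).
  apply is_series_ext with (2 := is_exp_Reals (2 * Rabs t)).
  intro n; rewrite pow_n_pow; reflexivity.
Qed.

(* Main.v *)
Require Import Defs.
From Stdlib Require Import Reals Arith Lra Lia.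
From Coquelicot Require Import Coquelicot.
Open Scope R_scope.

(** With [P = walk_step mu], the one-step operator of the killed walk, half the Laplacian is
    [P - 1]. So the heat semigroup is a Poisson average of the powers of [P]: [exp t * e^(t (P - 1))
    = sum_n t^n / n! * P^n] ([is_series_iter_walk_step]).

    The mass lost after [n] steps solves the walk's recursion with a source [(1 - mu) / 2] at the
    origin. For every [r >= 0] the function [cosh r ^ n * exp (- r k)] is a supersolution of that
    recursion: averaging [exp (- r k)] over the two neighbours multiplies it by [cosh r], and at the
    origin its value is at least 1, which absorbs the killing ([deficit_le]). Poisson averaging
    turns this into the bound [exp (t (cosh r - 1)) * exp (- r k)] ([heat_kernel_mass]).

    The powers of [eps] cancel in the claimed exponent, which is [- a k / sqrt t]; this dictates
    [r = a / sqrt t]. Since [t >= 1], [r <= a], and [t (cosh r - 1)] stays bounded because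
    [cosh r - 1] is of order [r^2]. *)

Lemma exp_le (x y : R) : x <= y -> exp x <= exp y.
Proof.
intros [H| ->]; [left; now apply exp_increasing|apply Rle_refl].
Qed.

Lemma exp_pow (x : R) (n : nat) : exp x ^ n = exp (x * INR n).
Proof.
induction n as [|n IH].
- now rewrite Rmult_0_r, exp_0.
- rewrite S_INR, Rmult_plus_distr_l, exp_plus, <- IH, Rmult_1_r; simpl; ring.
Qed.

(** * The killed walk and its Poisson average *)

Definition walk_step (mu : R) (f : nat -> R) (k : nat) : R :=
  match k with
  | O => (f 1%nat + mu * f 0%nat) / 2
  | S k' => (f (S k) + f k') / 2
  end.

Lemma walk_step_half_laplacian (mu : R) (f : nat -> R) (k : nat) :
  walk_step mu f k = half_laplacian mu 1 f k + f k.
Proof. unfold half_laplacian; destruct k; simpl; field. Qed.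

Lemma walk_step_ext (mu : R) (f g : nat -> R) :
  (forall k, f k = g k) -> forall k, walk_step mu f k = walk_step mu g k.
Proof. intros E [|k]; simpl; now rewrite !E. Qed.

Lemma walk_step_sum_n (mu : R) (g : nat -> nat -> R) (N k : nat) :
  walk_step mu (fun i => sum_n (fun j => g j i) N) k
  = sum_n (fun j => walk_step mu (g j) k) N.
Proof.
induction N as [|N IH].
- rewrite sum_O; apply walk_step_ext; intro i; apply sum_O.
- rewrite sum_Sn, <- IH; unfold plus; simpl.
  destruct k; simpl; rewrite !sum_Sn; unfold plus; simpl; field.
Qed.

Lemma iter_walk_step_nonneg (mu : R) (f : nat -> R) :
  0 <= mu -> (forall k, 0 <= f k) ->
  forall n k, 0 <= Nat.iter n (walk_step mu) f k.
Proof.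
intros Hmu Hf n; induction n as [|n IH]; intro k; [apply Hf|].
destruct k as [|k]; simpl.
- pose proof (IH 0%nat); pose proof (IH 1%nat); nra.
- pose proof (IH k); pose proof (IH (S (S k))); lra.
Qed.

Lemma iter_walk_step_succ_r (mu : R) (f : nat -> R) (n k : nat) :
  Nat.iter n (walk_step mu) (walk_step mu f) k
  = Nat.iter n (walk_step mu) (half_laplacian mu 1 f) k
    + Nat.iter n (walk_step mu) f k.
Proof.
revert k; induction n as [|n IH]; intro k.
- apply walk_step_half_laplacian.
- destruct k; simpl; rewrite !IH; field.
Qed.

Lemma iter_half_laplacian_scal (mu t : R) (f : nat -> R) (n k : nat) :
  Nat.iter n (half_laplacian mu t) f k
  = t ^ n * Nat.iter n (half_laplacian mu 1) f k.
Proof.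
revert k; induction n as [|n IH]; intro k; simpl; [ring|].
unfold half_laplacian at 1 3; destruct k; simpl; rewrite !IH; field.
Qed.

(** The binomial theorem for [P = A + 1] in scalar form: it is meant for [v n m = P^n A^m f] at a
    fixed site, where the recurrence reads [P^(n+1) A^m = P^n A^(m+1) + P^n A^m]. *)
Lemma pascal_recurrence_sum (v : nat -> nat -> R) :
  (forall n m, v (S n) m = v n (S m) + v n m) ->
  forall n m, v n m = sum_f_R0 (fun i => Binomial.C n i * v 0%nat (m + i)%nat) n.
Proof.
intros Hv n; induction n as [|n IH]; intro m.
- simpl; rewrite Nat.add_0_r; unfold Binomial.C; simpl; field.
- rewrite Hv, !IH.
  (* Pascal's rule applies to the inner terms of a row. The row with two terms has none, and
     [sum_f_R0] cannot express an empty sum, so that row is treated separately. *)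
  destruct n as [|n].
  + simpl; rewrite !Nat.add_0_r, Nat.add_1_r; unfold Binomial.C; simpl; field.
  + rewrite (decomp_sum (fun i => Binomial.C (S (S n)) i * _) (S (S n))) by lia.
    rewrite (decomp_sum (fun i => Binomial.C (S n) i * v 0%nat (m + i)%nat) (S n)) by lia.
    simpl pred; rewrite !tech5.
    assert (E : sum_f_R0 (fun i => Binomial.C (S (S n)) (S i) * v 0%nat (m + S i)%nat) n
      = sum_f_R0 (fun i => Binomial.C (S n) i * v 0%nat (S m + i)%nat) n
        + sum_f_R0 (fun i => Binomial.C (S n) (S i) * v 0%nat (m + S i)%nat) n).
    { rewrite <- sum_plus; apply sum_eq; intros i Hi.
      rewrite <- pascal by lia.
      replace (m + S i)%nat with (S m + i)%nat by lia; ring. }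
    rewrite E.
    replace (m + S (S n))%nat with (S m + S n)%nat by lia.
    rewrite !C_n_0, !C_n_n; ring.
Qed.

Lemma iter_walk_step_binomial (mu : R) (f : nat -> R) (n k : nat) :
  Nat.iter n (walk_step mu) f k
  = sum_f_R0 (fun i => Binomial.C n i * Nat.iter i (half_laplacian mu 1) f k) n.
Proof.
apply (pascal_recurrence_sum
  (fun n m => Nat.iter n (walk_step mu) (Nat.iter m (half_laplacian mu 1) f) k))
  with (m := 0%nat).
intros p m; rewrite Nat.iter_succ_r; apply iter_walk_step_succ_r.
Qed.

Lemma is_series_exp (x : R) : is_series (fun n => x ^ n / INR (fact n)) (exp x).
Proof.
apply is_series_ext with (2 := is_exp_Reals x).
intro n; rewrite pow_n_pow; reflexivity.
Qed.

Lemma ex_series_Rabs_iter_half_laplacian (mu t M : R) (f : nat -> R) (k : nat) :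
  0 <= mu <= 1 -> (forall i, Rabs (f i) <= M) ->
  ex_series (fun n => Rabs (Nat.iter n (half_laplacian mu t) f k / INR (fact n))).
Proof.
intros Hmu Hf.
apply (ex_series_le (K := R_AbsRing) (V := R_CompleteNormedModule) _
  (fun n => M * ((2 * Rabs t) ^ n / INR (fact n)))).
- intro n; change (Rabs (Rabs (Nat.iter n (half_laplacian mu t) f k / INR (fact n)))
    <= M * ((2 * Rabs t) ^ n / INR (fact n))).
  pose proof (INR_fact_lt_0 n) as Hn; pose proof (Rinv_0_lt_compat _ Hn).
  unfold Rdiv; rewrite Rabs_Rabsolu, Rabs_mult, (Rabs_pos_eq (/ _)) by lra.
  rewrite <- Rmult_assoc; apply Rmult_le_compat_r; [lra|].
  now apply iter_half_laplacian_bound.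
- apply (ex_series_scal_l M (fun n => (2 * Rabs t) ^ n / INR (fact n))).
  eexists; apply is_series_exp.
Qed.

(** The identity [e^(t P) = e^t e^(t A)] for [P = A + 1], obtained as the Cauchy product of two
    absolutely convergent series; the binomial expansion of [P^n] identifies the coefficients. *)
Lemma is_series_iter_walk_step (mu t M : R) (f : nat -> R) (k : nat) :
  0 <= mu <= 1 -> (forall i, Rabs (f i) <= M) ->
  is_series (fun n => t ^ n / INR (fact n) * Nat.iter n (walk_step mu) f k)
    (exp t * op_exp (half_laplacian mu t) f k).
Proof.
intros Hmu Hf; rewrite Rmult_comm.
eapply is_series_ext; [|apply is_series_mult; [apply Series_correct| | |]].
2: now apply ex_series_op_exp with M.
2: apply (is_series_exp t).
2: now apply ex_series_Rabs_iter_half_laplacian with M.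
- intro n; cbv beta; rewrite iter_walk_step_binomial, scal_sum.
  apply sum_eq; intros i Hi.
  rewrite iter_half_laplacian_scal.
  replace (t ^ n) with (t ^ i * t ^ (n - i)) by (rewrite <- pow_add; f_equal; lia).
  unfold Binomial.C; field; repeat split; apply INR_fact_neq_0.
- eapply ex_series_ext; [|eexists; apply (is_series_exp (Rabs t))].
  intro n; cbv beta; unfold Rdiv; rewrite Rabs_mult, RPow_abs, Rabs_inv.
  now rewrite (Rabs_pos_eq (INR _)) by apply pos_INR.
Qed.

(** * Mass lost by the walk, with targets truncated at [N] *)

Lemma dirac_bounds (l k : nat) : 0 <= dirac l k <= 1.
Proof. unfold dirac; destruct (Nat.eqb k l); lra. Qed.

Lemma sum_n_dirac (N k : nat) :
  sum_n (fun j => dirac j k) N = if Nat.leb k N then 1 else 0.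
Proof.
induction N as [|N IH].
- rewrite sum_O; now destruct k.
- rewrite sum_Sn, IH; unfold plus, dirac; simpl plus.
  destruct (Nat.leb_spec k N), (Nat.eqb_spec k (S N)), (Nat.leb_spec k (S N));
    simpl; (lia || lra).
Qed.

Section Deficit.

Variables (mu : R) (N : nat).
Hypothesis mu_bounds : 0 <= mu <= 1.

(** Only targets up to [N] are counted, so that the sum is finite and commutes with [walk_step] and
    with the Poisson series; [N] tends to infinity only in [heat_kernel_mass]. *)
Let deficit (n k : nat) : R :=
  1 - sum_n (fun j => Nat.iter n (walk_step mu) (dirac j) k) N.

(** [walk_step] preserves the constant 1 except at the origin, where the killing probability
    [(1 - mu) / 2] is missing. *)
Lemma deficit_succ (n k : nat) :
  deficit (S n) k
  = walk_step mu (deficit n) k + (if Nat.eqb k 0 then (1 - mu) / 2 else 0).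
Proof.
unfold deficit at 1; simpl Nat.iter; rewrite <- walk_step_sum_n.
destruct k; unfold deficit; simpl; field.
Qed.

Lemma deficit_nonneg (n k : nat) : 0 <= deficit n k.
Proof.
revert k; induction n as [|n IH]; intro k.
- unfold deficit; simpl; rewrite sum_n_dirac; destruct (Nat.leb k N); lra.
- rewrite deficit_succ; destruct k as [|k]; simpl.
  + pose proof (IH 0%nat); pose proof (IH 1%nat); nra.
  + pose proof (IH k); pose proof (IH (S (S k))); lra.
Qed.

(** The first term is the supersolution that controls killing. The second controls truncation:
    initially the deficit is the indicator of [k > N], which is at most [2 ^ k / 2 ^ N], and one
    step multiplies [2 ^ k] by at most 2. *)
Lemma deficit_le (r : R) (n k : nat) : 0 <= r ->
  deficit n k <= cosh r ^ n * exp (- r) ^ k + 2 ^ n * (2 ^ k / 2 ^ N).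
Proof.
intro Hr.
assert (Hs : 0 < exp (- r) <= 1).
{ split; [apply exp_pos|]; rewrite <- exp_0; apply exp_le; lra. }
(* This says that [exp (- r) ^ k] is an eigenfunction of the neighbour average, with eigenvalue
   [cosh r]. *)
assert (Hc : 2 * cosh r * exp (- r) = 1 + exp (- r) * exp (- r)).
{ unfold cosh; assert (exp r * exp (- r) = 1)
    by (rewrite <- exp_plus, Rplus_opp_r; apply exp_0); nra. }
assert (Hc1 : 1 <= cosh r) by nra.
set (s := exp (- r)) in *; set (c := cosh r) in *.
assert (HN : 0 < / 2 ^ N) by (apply Rinv_0_lt_compat, pow_lt; lra).
revert k; induction n as [|n IH]; intro k.
- pose proof (pow_lt s k (proj1 Hs)).
  unfold deficit; simpl; rewrite sum_n_dirac; destruct (Nat.leb_spec k N) as [H'|H'].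
  + pose proof (pow_lt 2 k); unfold Rdiv; nra.
  + assert (1 <= 2 ^ k / 2 ^ N); [|lra].
    apply (Rmult_le_reg_r (2 ^ N)); [apply pow_lt; lra|].
    unfold Rdiv; rewrite Rmult_assoc, Rinv_l, Rmult_1_l, Rmult_1_r
      by (apply pow_nonzero; lra).
    apply Rle_pow; [lra|lia].
- rewrite deficit_succ.
  assert (HA : 1 <= c ^ n) by now apply pow_R1_Rle.
  assert (HB : 0 < 2 ^ n) by (apply pow_lt; lra).
  destruct k as [|k]; simpl.
  (* At the origin the source is absorbed because [1 <= c ^ n]: the total is at most
     [c ^ n * (1 + s) / 2], up to the truncation term, and [(1 + s) / 2 <= 1 <= c]. *)
  + pose proof (IH 0%nat) as I0; pose proof (IH 1%nat) as I1; simpl in I0, I1.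
    unfold Rdiv in *; set (A := c ^ n) in *; set (B := 2 ^ n) in *.
    set (d := / 2 ^ N) in *.
    assert (0 < B * d) by now apply Rmult_lt_0_compat.
    assert (mu * deficit n 0 <= mu * (A * 1 + B * (1 * d)))
      by (apply Rmult_le_compat_l; lra).
    assert ((1 - mu) * 1 <= (1 - mu) * A) by (apply Rmult_le_compat_l; lra).
    assert (mu * (B * d) <= 1 * (B * d)) by (apply Rmult_le_compat_r; lra).
    assert (A * s <= A * 1) by (apply Rmult_le_compat_l; lra).
    assert (A * 1 <= A * c) by (apply Rmult_le_compat_l; lra).
    nra.
  + pose proof (IH k) as I0; pose proof (IH (S (S k))) as I1; simpl in I0, I1.
    unfold Rdiv in *; set (A := c ^ n) in *; set (B := 2 ^ n) in *.
    assert (0 < B * (2 ^ k * / 2 ^ N)).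
    { repeat apply Rmult_lt_0_compat; trivial; apply pow_lt; lra. }
    set (x := s ^ k) in *.
    assert (E : c * A * (s * x) = (A * x + A * (s * (s * x))) / 2).
    { replace (c * A * (s * x)) with (2 * c * s * (A * x) / 2) by field.
      rewrite Hc; field. }
    rewrite E; nra.
Qed.

Lemma is_series_deficit (t : R) (k : nat) :
  is_series (fun n => t ^ n / INR (fact n) * deficit n k)
    (exp t * (1 - sum_n (fun j => op_exp (half_laplacian mu t) (dirac j) k) N)).
Proof.
assert (H : is_series
  (fun n => t ^ n / INR (fact n)
            * sum_n (fun j => Nat.iter n (walk_step mu) (dirac j) k) N)
  (exp t * sum_n (fun j => op_exp (half_laplacian mu t) (dirac j) k) N)).
{ assert (D : forall j, is_series
    (fun n => t ^ n / INR (fact n) * Nat.iter n (walk_step mu) (dirac j) k)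
    (exp t * op_exp (half_laplacian mu t) (dirac j) k)).
  { intro j; apply is_series_iter_walk_step with 1; trivial.
    intro i; pose proof (dirac_bounds j i); apply Rabs_le; lra. }
  clear deficit; induction N as [|m IH].
  - rewrite sum_O; eapply is_series_ext; [|apply D].
    intro n; now rewrite sum_O.
  - rewrite sum_Sn; unfold plus; simpl plus; rewrite Rmult_plus_distr_l.
    eapply is_series_ext; [|apply (is_series_plus _ _ _ _ IH (D (S m)))].
    intro n; cbv beta; rewrite sum_Sn; unfold plus; simpl; ring. }
replace (exp t * (1 - _))
  with (exp t - exp t * sum_n (fun j => op_exp (half_laplacian mu t) (dirac j) k) N)
  by ring.
eapply is_series_ext; [|apply (is_series_minus _ _ _ _ (is_series_exp t) H)].
intro n; unfold deficit, plus, opp; simpl; ring.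
Qed.

Lemma mass_deficit_bounds (r t : R) (k : nat) : 0 <= r -> 0 <= t ->
  0 <= 1 - sum_n (fun j => op_exp (half_laplacian mu t) (dirac j) k) N
    <= exp (t * (cosh r - 1)) * exp (- r) ^ k + exp t * 2 ^ k * (/ 2) ^ N.
Proof.
intros Hr Ht.
pose proof (is_series_deficit t k) as H.
assert (Hw : forall n, 0 <= t ^ n / INR (fact n)).
{ intro n; apply Rdiv_le_0_compat; [now apply pow_le|apply INR_fact_lt_0]. }
(* Both terms of [deficit_le] are geometric in [n], so their Poisson sums are exponentials. *)
assert (Hb : is_series
  (fun n => t ^ n / INR (fact n)
     * (cosh r ^ n * exp (- r) ^ k + 2 ^ n * (2 ^ k / 2 ^ N)))
  (exp (- r) ^ k * exp (t * cosh r) + 2 ^ k / 2 ^ N * exp (t * 2))).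
{ eapply is_series_ext; [|apply (is_series_plus _ _ _ _
    (is_series_scal (exp (- r) ^ k) _ _ (is_series_exp (t * cosh r)))
    (is_series_scal (2 ^ k / 2 ^ N) _ _ (is_series_exp (t * 2))))].
  intro n; unfold plus, scal; simpl; unfold mult; simpl.
  rewrite !Rpow_mult_distr; field.
  split; [apply pow_nonzero; lra|apply INR_fact_neq_0]. }
pose proof (exp_pos t) as He.
split; apply (Rmult_le_reg_l (exp t)); trivial.
- rewrite Rmult_0_r, <- (is_series_unique _ _ H).
  (* Zero is rewritten as a series of zero terms, so that the series can be compared term by
     term. *)
  rewrite <- (Rmult_0_l (Series (fun n => t ^ n / INR (fact n)))), <- Series_scal_l.
  apply Series_le; [|eexists; apply H].
  intro n; rewrite Rmult_0_l; split; [lra|].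
  apply Rmult_le_pos; [apply Hw|apply deficit_nonneg].
- rewrite <- (is_series_unique _ _ H).
  replace (exp t * (exp (t * (cosh r - 1)) * _ + _))
    with (exp (- r) ^ k * exp (t * cosh r) + 2 ^ k / 2 ^ N * exp (t * 2)).
  + rewrite <- (is_series_unique _ _ Hb); apply Series_le; [|eexists; apply Hb].
    intro n; split.
    * apply Rmult_le_pos; [apply Hw|apply deficit_nonneg].
    * apply Rmult_le_compat_l; [apply Hw|now apply deficit_le].
  + replace (t * cosh r) with (t + t * (cosh r - 1)) by ring.
    replace (t * 2) with (t + t) by ring.
    rewrite !exp_plus, pow_inv; unfold Rdiv; ring.
Qed.

End Deficit.

(** * Mass of the heat kernel and choice of the decay rate *)

Lemma cosh_sub_1_le (r : R) : 0 <= r -> cosh r - 1 <= r ^ 2 * exp r / 2.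
Proof.
intro Hr.
assert (E : exp r * exp (- r) = 1)
  by (rewrite <- exp_plus, Rplus_opp_r; apply exp_0).
pose proof (exp_ineq1_le (- r)) as H1.
assert (H2 : exp (- r) <= 1) by (rewrite <- exp_0; apply exp_le; lra).
pose proof (exp_pos r) as Hp.
(* The left side equals [2 * (cosh r - 1)], and [0 <= 1 - exp (- r) <= r]. *)
assert (H3 : exp r * (1 - exp (- r)) ^ 2 <= exp r * r ^ 2).
{ apply Rmult_le_compat_l; [lra|]; apply pow_incr; lra. }
unfold cosh; nra.
Qed.

(** The half-Laplacian has negative diagonal entries, so the sign is read off the Poisson average,
    whose terms are all nonnegative. *)
Lemma heat_kernel_nonneg (eps t : R) (k l : nat) :
  0 < eps -> 0 <= t -> 0 <= heat_kernel eps t k l.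
Proof.
intros Heps Ht.
assert (Hmu : 0 <= exp (- eps) <= 1).
{ split; [left; apply exp_pos|]; rewrite <- exp_0; apply exp_le; lra. }
assert (Hd : forall i, Rabs (dirac l i) <= 1).
{ intro i; pose proof (dirac_bounds l i); apply Rabs_le; lra. }
pose proof (is_series_iter_walk_step _ t 1 _ k Hmu Hd) as H.
apply (Rmult_le_reg_l (exp t)); [apply exp_pos|].
unfold heat_kernel; rewrite Rmult_0_r, <- (is_series_unique _ _ H).
rewrite <- (Rmult_0_l (Series (fun n => t ^ n / INR (fact n)))), <- Series_scal_l.
apply Series_le; [|eexists; apply H].
intro n; rewrite Rmult_0_l; split; [lra|].
apply Rmult_le_pos.
- apply Rdiv_le_0_compat; [now apply pow_le|apply INR_fact_lt_0].
- apply iter_walk_step_nonneg; [lra|]; intro; apply dirac_bounds.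
Qed.

Lemma heat_kernel_mass (eps r t : R) (k : nat) : 0 < eps -> 0 <= r -> 0 <= t ->
  ex_series (fun j => heat_kernel eps t k j) /\
  0 <= 1 - Series (fun j => heat_kernel eps t k j)
    <= exp (t * (cosh r - 1)) * exp (- r) ^ k.
Proof.
intros Heps Hr Ht.
assert (Hmu : 0 <= exp (- eps) <= 1).
{ split; [left; apply exp_pos|]; rewrite <- exp_0; apply exp_le; lra. }
pose proof (fun N => mass_deficit_bounds _ N Hmu r t k Hr Ht) as B.
fold (heat_kernel eps t k) in B.
(* The partial sums increase, as the kernel is nonnegative, and are at most 1, as the truncated
   deficit is nonnegative. *)
assert (Hex : ex_series (fun j => heat_kernel eps t k j)).
{ destruct (ex_finite_lim_seq_incr (sum_n (heat_kernel eps t k)) 1) as [l Hl].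
  - intro N; rewrite sum_Sn; unfold plus; simpl.
    pose proof (heat_kernel_nonneg eps t k (S N) Heps Ht); lra.
  - intro N; destruct (B N) as [B1 _]; unfold heat_kernel in *; lra.
  - exists l; exact Hl. }
split; [exact Hex|].
assert (HS : is_lim_seq (fun N => 1 - sum_n (heat_kernel eps t k) N)
  (1 - Series (heat_kernel eps t k))).
{ apply is_lim_seq_minus'; [apply is_lim_seq_const|apply (Series_correct _ Hex)]. }
set (b := exp (t * (cosh r - 1)) * exp (- r) ^ k) in *.
(* For fixed [t] and [k] the truncation error decays geometrically in [N]. *)
assert (HB : is_lim_seq (fun N => b + exp t * 2 ^ k * (/ 2) ^ N) b).
{ replace (Finite b) with (Finite (b + 0)) by now rewrite Rplus_0_r.
  apply is_lim_seq_plus'; [apply is_lim_seq_const|].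
  rewrite <- (Rmult_0_r (exp t * 2 ^ k)).
  apply is_lim_seq_mult'; [apply is_lim_seq_const|].
  apply is_lim_seq_geom; rewrite Rabs_pos_eq; lra. }
split.
- apply (is_lim_seq_le _ _ 0 _ (fun N => proj1 (B N)) (is_lim_seq_const 0) HS).
- apply (is_lim_seq_le _ _ _ _ (fun N => proj2 (B N)) HS HB).
Qed.

Theorem lemma5p8 :
  forall a T : R, 0 < a -> 0 < T ->
  exists C : R, 0 <= C /\
    forall eps : R, 0 < eps ->
    forall (k : nat) (t : R), 1 <= t <= / eps ^ 4 * T ->
      ex_series (fun j : nat => heat_kernel eps t k j) /\
      Rabs (1 - Series (fun j : nat => heat_kernel eps t k j))
        <= C * exp (- a * (eps ^ 2 * INR k / sqrt (eps ^ 4 * t))).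
Proof.
intros a T Ha _.
(* With [r = a / sqrt t <= a], [t * (cosh r - 1) <= t * r ^ 2 * exp r / 2 <= a ^ 2 * exp a / 2]. *)
exists (exp (a ^ 2 * exp a / 2)); split; [left; apply exp_pos|].
intros eps Heps k t [Ht _].
assert (Hq : 1 <= sqrt t) by (rewrite <- sqrt_1; now apply sqrt_le_1_alt).
assert (Hqq : sqrt t * sqrt t = t) by (apply sqrt_sqrt; lra).
set (r := a / sqrt t).
assert (Er : r * sqrt t = a) by (unfold r; field; lra).
assert (Hr : 0 <= r <= a).
{ split; [unfold r; apply Rdiv_le_0_compat; lra|].
  assert (0 < r) by (unfold r; apply Rdiv_lt_0_compat; lra); nra. }
destruct (heat_kernel_mass eps r t k Heps (proj1 Hr)) as [Hex [Hlo Hhi]]; [lra|].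
split; [exact Hex|].
rewrite Rabs_pos_eq by exact Hlo.
apply Rle_trans with (1 := Hhi).
replace (exp (- a * _)) with (exp (- r) ^ k).
- apply Rmult_le_compat_r; [apply pow_le; left; apply exp_pos|].
  apply exp_le.
  apply Rle_trans with (t * (r ^ 2 * exp r / 2)).
  + apply Rmult_le_compat_l; [lra|]; now apply cosh_sub_1_le.
  + replace (t * (r ^ 2 * exp r / 2)) with (a ^ 2 * (exp r / 2))
      by (rewrite <- Hqq, <- Er; field).
    unfold Rdiv; rewrite Rmult_assoc; apply Rmult_le_compat_l; [apply pow2_ge_0|].
    apply Rmult_le_compat_r; [lra|]; apply exp_le; lra.
- rewrite exp_pow; f_equal.
  (* Now [eps ^ 2] comes out of the square root and cancels. *)
  replace (eps ^ 4 * t) with ((eps ^ 2) ^ 2 * t) by ring.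
  rewrite sqrt_mult, sqrt_pow2 by (try apply pow2_ge_0; lra).
  unfold r; field; lra.
Qed.
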